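(* Let $(e_n)$ be a basis of a Banach space $X$. Then the following assertions are equivalent: (a) $(e_n)$ is partially greedy. (b) $(e_n)$ satisfies property $( * )$: there exists a constant $C$ such that for all $x\in X$ and $m\in\mathbb{N}$, $$\|x-G_m(x)\|\le C\,\sigma_m^L(x),\qquad\text{where }\sigma_m^L(x)=\inf\Big\{\Big\|x-\sum_{i\in A}a_ie_i\Big\| : |A|\le m,\ A<\alpha_m(x),\ a_i\in\mathbb{R}\ (i\in A)\Big\}.$$
   Context: Standing setting: $X$ is a real Banach space, possibly finite-dimensional, and $(e_n)$ is a seminormalized Schauder basis of $X$ (i.e. $0<\inf_n\|e_n\|\le\sup_n\|e_n\|<\infty$), with biorthogonal functionals $(e_n^* )$. If $\dim X=N<\infty$, $(e_n)_{n=1}^N$ is an algebraic basis, all indices and index sets lie in $\{1,\dots,N\}$ instead of $\mathbb{N}$, and $m\le N$. $\mathrm{supp}(x)=\{n: e_n^*(x)\ne0\}$; $|A|$ is the cardinality of an index set $A$; for an integer $a$, $A<a$ means every element of $A$ is $<a$ (vacuous if $A=\emptyset$). Greedy approximation: a greedy ordering for $x\in X$ is an injective map $\rho$ from the index set into itself with $\mathrm{supp}(x)$ contained in the range of $\rho$ and $|e_{\rho(j)}^*(x)|\ge|e_{\rho(k)}^*(x)|$ whenever $j<k$. Put $\Lambda_m(x)=\{\rho(1),\dots,\rho(m)\}$, $G_m(x)=\sum_{n\in\Lambda_m(x)}e_n^*(x)e_n$, $\alpha_m(x)=\min\Lambda_m(x)$. Statements involving $G_m(x)$, $\Lambda_m(x)$,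 $\alpha_m(x)$ are meant for any greedy ordering of $x$ (the same ordering throughout the statement). Definition: $(e_n)$ is partially greedy if there is $C$ with $\|x-G_m(x)\|\le C\|\sum_{n>m}e_n^*(x)e_n\|$ for all $x\in X$, $m\in\mathbb{N}$. *)

(* Defs.v *)
From HB Require Import structures.
From mathcomp Require Import all_boot all_order all_algebra finmap.
From mathcomp Require Import all_classical all_reals all_analysis.

Set Implicit Arguments.
Unset Strict Implicit.
Unset Printing Implicit Defensive.

Import Order.TTheory GRing.Theory Num.Theory.
Import numFieldNormedType.Exports.

Local Open Scope classical_set_scope.
Local Open Scope ring_scope.

Section Greedy.
Context {R : realType} {X : completeNormedModType R}.

(* The dimension is [Some N] if [X] has dimension [N], and [None] if [X] is
   infinite-dimensional. Indices start at 1; the values of the families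
   [e], [es] and of [rho] outside [indices d] are irrelevant. *)
Definition indices (d : option nat) : set nat :=
  if d is Some N then [set n | (1 <= n <= N)%N] else [set n | (1 <= n)%N].

(* The sum of the [u n] over the indices [n > m]. *)
Definition tail_sum (d : option nat) (u : nat -> X) (m : nat) : X :=
  if d is Some N then \sum_(m.+1 <= n < N.+1) u n
  else limn (fun k => \sum_(m.+1 <= n < k.+1) u n).

Definition expansion (d : option nat) (e : nat -> X) (x : X) (a : nat -> R) :
    Prop :=
  if d is Some N then \sum_(1 <= n < N.+1) a n *: e n = x
  else (fun k => \sum_(1 <= n < k.+1) a n *: e n) @ \oo --> x.

Definition schauder_basis (d : option nat) (e : nat -> X) : Prop :=
  forall x : X, exists a : nat -> R, expansion d e x a /\
    forall b : nat -> R, expansion d e x b -> {in indices d, a =1 b}.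

Definition seminormalized (d : option nat) (e : nat -> X) : Prop :=
  (0 < ereal_inf [set (`|e n|%:E : \bar R) | n in indices d])%E /\
  (ereal_sup [set (`|e n|%:E : \bar R) | n in indices d] < +oo)%E.

Definition biorthogonal (d : option nat) (e : nat -> X)
    (es : nat -> {linear X -> R^o}) : Prop :=
  (forall i, indices d i -> continuous (es i)) /\
  (forall i j, indices d i -> indices d j -> es i (e j) = (i == j)%:R).

Definition supp (d : option nat) (es : nat -> {linear X -> R^o}) (x : X) :
    set nat :=
  [set n | indices d n /\ es n x != 0].

Definition greedy_ordering (d : option nat) (es : nat -> {linear X -> R^o})
    (x : X) (rho : nat -> nat) : Prop :=
  [/\ (forall j, indices d j -> indices d (rho j)),
      {in indices d &, injective rho},
      supp d es x `<=` rho @` indices d &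
      forall j k, indices d j -> indices d k -> (j < k)%N ->
        `|es (rho k) x| <= `|es (rho j) x| ].

Definition Lambda (rho : nat -> nat) (m : nat) : {fset nat} :=
  [fset rho j | j in iota 1 m]%fset.

Definition G (e : nat -> X) (es : nat -> {linear X -> R^o}) (x : X)
    (rho : nat -> nat) (m : nat) : X :=
  \sum_(n <- Lambda rho m) es n x *: e n.

(* The minimum of [Lambda rho m] when [1 <= m], as [rho 1] is then in it. *)
Definition alpha (rho : nat -> nat) (m : nat) : nat :=
  \big[minn/rho 1%N]_(n <- Lambda rho m) n.

Definition sigmaL (d : option nat) (e : nat -> X) (x : X) (rho : nat -> nat)
    (m : nat) : R :=
  inf [set r | exists (A : {fset nat}) (a : nat -> R),
    [/\ [set` A] `<=` indices d, (#|` A| <= m)%N,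
        (forall i, i \in A -> (i < alpha rho m)%N) &
        r = `|x - \sum_(i <- A) a i *: e i| ] ].

Definition partially_greedy (d : option nat) (e : nat -> X)
    (es : nat -> {linear X -> R^o}) : Prop :=
  exists C : R, forall (x : X) (rho : nat -> nat) (m : nat),
    greedy_ordering d es x rho -> indices d m ->
    `|x - G e es x rho m| <= C * `|tail_sum d (fun n => es n x *: e n) m|.

Definition property_star (d : option nat) (e : nat -> X)
    (es : nat -> {linear X -> R^o}) : Prop :=
  exists C : R, forall (x : X) (rho : nat -> nat) (m : nat),
    greedy_ordering d es x rho -> indices d m ->
    `|x - G e es x rho m| <= C * sigmaL d e x rho m.

End Greedy.

(* Main.v *)
(* For a finite index set L put P_L x = sum_{n in L} e_n^*(x) e_n, and let T_k x
   be the tail of x beyond k. Both properties are used for greedy sets L of x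
   (|e_n^*(x)| >= |e_j^*(x)| for n in L, j not in L): since the coefficients
   of x tend to 0, every finite greedy set is an initial part of some greedy
   ordering.

   (b) => (a): with B the part of L = Lambda_m(x) inside {1..m}, L \ B is a
   greedy set of z = x - P_B x lying beyond D = {1..m} \ L, and
   |D| = |L \ B|. Moreover z - P_(L \ B) z = x - P_L x and z - P_D z = T_m x,
   so (b) for z gives (a) for x.

   (a) => (b): let L = Lambda_m(x), y = x - sum_A a_i e_i, M = alpha_m(x) - 1,
   and let t be the least modulus of the coefficients of x on L. For any
   coefficients u on A bounded by t, the set B + L with B = {1..M} \ A is greedy
   for w = T_M x + sum_A u_i e_i + sum_B t e_i, and has at least M elements, so
   that w and y have the same tail beyond |B + L|. As the tail operators are
   uniformly bounded by some K (Banach-Steinhaus), (a) gives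
   ||T_M x - P_L x + sum_A u_i e_i|| <= C K ||y||. Likewise A1 + L is greedy for
   y, where A1 is the set of i in A with |e_i^*(y)| >= t, hence
   ||y - P_(A1 + L) y|| <= C K ||y||. Now x - P_L x is y - P_(A1 + L) y plus the
   difference of two vectors of the former kind, one with u_i = e_i^*(x) and
   one with u_i = e_i^*(y) off A1 and 0 on A1. So (b) holds with 3 C K. *)

From HB Require Import structures.
Require Import Defs.
From mathcomp Require Import all_boot all_order all_algebra finmap.
From mathcomp Require Import all_classical all_reals all_analysis.
From mathcomp Require Import zify.

Set Implicit Arguments.
Unset Strict Implicit.
Unset Printing Implicit Defensive.

Import Order.TTheory GRing.Theory Num.Theory.
Import numFieldNormedType.Exports.

Local Open Scope classical_set_scope.
Local Open Scope ring_scope.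

(** * Finite index sets and sums over them *)

Definition initial (k : nat) : {fset nat} := [fset n in iota 1 k]%fset.

Lemma in_initial k n : (n \in initial k) = (1 <= n <= k)%N.
Proof. by rewrite in_fset mem_iota; lia. Qed.

Lemma card_initial k : #|` initial k| = k.
Proof. by rewrite card_fseq undup_id ?iota_uniq// size_iota. Qed.

Lemma initial_subset k l : (k <= l)%N -> (initial k `<=` initial l)%fset.
Proof. by move=> kl; apply/fsubsetP => n; rewrite !in_initial; lia. Qed.

Lemma big_initial (V : zmodType) (F : nat -> V) k :
  \sum_(n <- initial k) F n = \sum_(1 <= n < k.+1) F n.
Proof.
apply: perm_big; apply: uniq_perm; rewrite ?fset_uniq ?iota_uniq//.
by move=> n; rewrite in_initial mem_index_iota ltnS.
Qed.

Lemma LambdaP rho m n :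
  reflect (exists2 j, (1 <= j <= m)%N & n = rho j) (n \in Lambda rho m).
Proof.
apply: (iffP (imfsetP _ _ _ _)) => /= -[j jm ->]; exists j => //.
  by move: jm; rewrite mem_iota; lia.
by rewrite mem_iota; lia.
Qed.

Lemma LambdaS rho m : Lambda rho m.+1 = (rho m.+1 |` Lambda rho m)%fset.
Proof.
apply/fsetP => n; rewrite in_fset1U; apply/idP/idP.
  move=> /LambdaP[j jm ->]; have [->|jNm] := eqVneq j m.+1.
    by rewrite eqxx.
  by apply/orP; right; apply/LambdaP; exists j => //; lia.
move=> /orP[/eqP->|/LambdaP[j jm ->]]; apply/LambdaP.
  by exists m.+1 => //; lia.
by exists j => //; lia.
Qed.

Lemma Lambda0 rho : Lambda rho 0 = fset0.
Proof.
apply/fsetP => n; rewrite in_fset0; apply/negbTE/negP => /LambdaP[j].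
lia.
Qed.

Lemma big_fsetIDset (V : zmodType) (A B : {fset nat}) (F : nat -> V) :
  \sum_(n <- A) F n = \sum_(n <- (A `&` B)%fset) F n
                      + \sum_(n <- (A `\` B)%fset) F n.
Proof.
rewrite (big_fsetID _ [pred n | n \in B])/=; congr (_ + _).
  by apply: eq_fbigl => n; rewrite !inE.
by apply: eq_fbigl => n; rewrite !inE andbC.
Qed.

Lemma big_fsetUdisj (V : zmodType) (A B : {fset nat}) (F : nat -> V) :
  [disjoint A & B]%fset ->
  \sum_(n <- (A `|` B)%fset) F n = \sum_(n <- A) F n + \sum_(n <- B) F n.
Proof.
move=> AB; rewrite (big_fsetIDset _ A) (fsetIidPr (fsubsetUl A B)).
rewrite fsetDUl fsetDv fset0U.
by congr (_ + _); move: AB; rewrite fdisjoint_sym => /fsetDidPl ->.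
Qed.

Section indices.
Context (d : option nat).

Lemma indices_gt0 n : indices d n -> (0 < n)%N.
Proof. by case: d => [N|]//= /andP[]. Qed.

Lemma indices_le k n : (0 < k <= n)%N -> indices d n -> indices d k.
Proof. by case: d => [N|]/=; lia. Qed.

Lemma initial_indices k : indices d k -> [set` initial k] `<=` indices d.
Proof.
move=> dk n /=; rewrite in_initial => nk; apply: indices_le dk; lia.
Qed.

Lemma card_indices (A : {fset nat}) :
  [set` A] `<=` indices d -> A != fset0 -> indices d #|` A|.
Proof.
rewrite -cardfs_gt0; case: d => [N|]//= AN A0; rewrite A0/=.
rewrite -[leqRHS]card_initial; apply: fsubset_leq_card.
by apply/fsubsetP => n nA; rewrite in_initial; exact: AN.
Qed.

(** Pigeonhole: the hypothesis says that the dimension exceeds [#|]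
    A|[, and]A[is too small to contain the first]#|[A|.+1] indices. *)
Lemma index_notin (A : {fset nat}) :
  indices d #|` A|.+1 -> exists2 n, indices d n & n \notin A.
Proof.
move=> dA; apply: contrapT => /forallPNP AN.
have : (initial #|` A|.+1 `<=` A)%fset.
  apply/fsubsetP => n /(initial_indices dA) dn.
  by apply/negPn/negP; exact: AN.
by move=> /fsubset_leq_card; rewrite card_initial ltnn.
Qed.

End indices.

(** * Greedy orderings with a prescribed initial part *)

Section greedy_ordering_existence.
Context {R : realType} (d : option nat).
Implicit Types (c : nat -> R) (A s L : {fset nat}) (D : set nat).

Definition vanishing c : Prop :=
  forall r : R, 0 < r ->
    exists N, forall n, indices d n -> (N <= n)%N -> c n < r.

(** If [c] has a positive value [c b] on [D], only finitely many indices have a value at least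
    [c b], so the maximum is taken over a finite range. *)
Lemma exists_argmax c D : (forall n, 0 <= c n) -> vanishing c ->
  D `<=` indices d -> D !=set0 -> exists2 n, D n & forall j, D j -> c j <= c n.
Proof.
move=> c0 cv Dd [a Da].
have [ca0|] := pselect (forall j, D j -> c j <= 0).
  by exists a => // j /ca0 /le_trans; apply.
move=> /existsNP[b /not_implyP[Db /negP]].
rewrite -ltNge => /cv[N cN].
have bN : (b < N)%N.
  by rewrite ltnNge; apply/negP => /(cN _ (Dd _ Db)); rewrite ltxx.
pose P := fun i : 'I_N => `[< D i >].
have Pb : P (Ordinal bN) by apply/asboolP.
case: (Order.TotalTheory.arg_maxP (fun i : 'I_N => c i) Pb) => i /asboolP Di ci.
exists i => // j Dj; have [jN|Nj] := ltnP j N.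
  by apply: (ci (Ordinal jN)); apply/asboolP.
by rewrite (le_trans (ltW (cN _ (Dd _ Dj) Nj)))//; apply: (ci _ Pb).
Qed.

(** One greedy choice, [s] being the set of indices already chosen; the last clause makes the choice
    exhaust [L] first. The existence of a free index is a premise under the quantifier, so that a
    choice function is defined on every [s]. *)
Lemma exists_next c L s : (forall n, 0 <= c n) -> vanishing c ->
  [set` L] `<=` indices d ->
  (forall n j, n \in L -> j \notin L -> indices d j -> c j <= c n) ->
  exists n, (exists2 j, indices d j & j \notin s) ->
    [/\ indices d n, n \notin s,
        forall j, indices d j -> j \notin s -> c j <= c n &
        forall j, j \in L -> j \notin s -> n \in L].
Proof.
move=> c0 cv Ld gL.
have [[l lL ls]|/forallPNP Ls] := pselect (exists2 j, j \in L & j \notin s).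
  have [||n [nL ns] nmax] :=
    @exists_argmax c [set j | j \in L /\ j \notin s] c0 cv.
  - by move=> j [/Ld].
  - by exists l.
  exists n => _; split => //; first exact: Ld.
  move=> j dj js; have [jL|jL] := boolP (j \in L); first exact: nmax.
  exact: gL.
have [[j dj js]|nos] := pselect (exists2 j, indices d j & j \notin s);
  last by exists 0%N.
have [||n [dn ns] nmax] :=
  @exists_argmax c [set j | indices d j /\ j \notin s] c0 cv.
- by move=> ? [].
- by exists j.
exists n => _; split => //; first by move=> i di si; exact: nmax.
by move=> i /Ls.
Qed.

Lemma greedy_order_exists c L : (forall n, 0 <= c n) -> vanishing c ->
  [set` L] `<=` indices d ->
  (forall n j, n \in L -> j \notin L -> indices d j -> c j <= c n) ->
  exists rho : nat -> nat,
    [/\ forall j, indices d j -> indices d (rho j),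
        {in indices d &, injective rho},
        [set n | indices d n /\ 0 < c n] `<=` rho @` indices d,
        forall j k, indices d j -> indices d k -> (j < k)%N ->
          c (rho k) <= c (rho j) &
        Lambda rho #|` L| = L].
Proof.
move=> c0 cv Ld gL.
have [f fP] := boolp.choice (fun s => exists_next s c0 cv Ld gL).
(* [p k] is the set of the first [k] choices, and [rho j] is the choice made after [j - 1] of them,
   as indices start at 1. *)
pose p k := iter k (fun s => f s |` s)%fset fset0.
pose rho j := f (p j.-1).
have pE k : p k = Lambda rho k.
  by elim: k => [|k IHk]; rewrite ?Lambda0// LambdaS -IHk.
have pmem j k : (0 < j <= k)%N -> rho j \in p k.
  by move=> jk; rewrite pE; apply/LambdaP; exists j.
(* [k = 0 \/ indices d k] says that [k] is at most the dimension. *)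
have dS k : indices d k.+1 -> k = 0%N \/ indices d k.
  by case: k => [|k] dk; [left|right; apply: indices_le dk; lia].
have pd k : k = 0%N \/ indices d k -> #|` p k| = k.
  elim: k => [|k IHk]; first by rewrite cardfs0.
  case=> // dk; have pk := IHk (dS _ dk).
  have [|_ fk _ _] := fP (p k); first by apply: index_notin; rewrite pk.
  by rewrite [p _.+1]/= cardfsU1 fk pk.
have next k : indices d k -> [/\ indices d (rho k), rho k \notin p k.-1,
        forall j, indices d j -> j \notin p k.-1 -> c j <= c (rho k) &
        forall j, j \in L -> j \notin p k.-1 -> rho k \in L].
  move=> dk; apply: fP; apply: index_notin.
  have k0 := indices_gt0 dk; rewrite pd ?prednK//.
  by apply: dS; rewrite prednK.
have rhod j : indices d j -> indices d (rho j) by move=> /next[].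
have rho_neq j k : indices d j -> indices d k -> (j < k)%N -> rho j != rho k.
  move=> dj dk jk; apply/eqP => rjk.
  have [_ /negP + _ _] := next _ dk; apply; rewrite -rjk.
  by apply: pmem; have := indices_gt0 dj; lia.
have pind k : k = 0%N \/ indices d k -> [set` p k] `<=` indices d.
  move=> dk n /=; rewrite pE => /LambdaP[j jk ->]; apply: rhod.
  by case: dk jk => [->|dk jk]; [lia|apply: indices_le dk].
exists rho; split => //.
- move=> j k /[!inE] dj dk rjk; apply/eqP; case: (ltngtP j k) => // jk.
    by move: (rho_neq _ _ dj dk jk); rewrite rjk eqxx.
  by move: (rho_neq _ _ dk dj jk); rewrite rjk eqxx.
- move=> n [dn cn]; apply: contrapT => nrho.
  have np k : k = 0%N \/ indices d k -> n \notin p k.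
    move=> dk; rewrite pE; apply/LambdaP => -[j jk njE].
    apply: nrho; exists j => //.
    by case: dk jk => [->|dk jk]; [lia|apply: indices_le dk].
  have cnr k : indices d k -> c n <= c (rho k).
    move=> dk; have [_ _ + _] := next _ dk; apply => //; apply: np.
    by apply: dS; rewrite prednK// (indices_gt0 dk).
  (* If [n] is never chosen, all chosen [j] satisfy [c n <= c j]; there are
     too few such indices other than [n]. *)
  have [K dK [F pF FK]] : exists2 K, indices d K &
      exists2 F : {fset nat}, (p K `<=` F)%fset & (#|` F| < K)%N.
    case dE : d => [N|]/=.
      move: (dn); rewrite dE /= => nN.
      have dN : indices d N by rewrite dE /=; lia.
      exists N; first by lia.
      exists (initial N `\ n)%fset; last first.
        have := cardfsD1 n (initial N).
        by rewrite card_initial in_initial nN add1n => {2}->.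
      rewrite fsubsetD1 np ?andbT; last by right.
      apply/fsubsetP => i /(pind _ (or_intror dN)).
      by rewrite in_initial dE.
    (* From [K] on, the values of [c] are below [c n], so every chosen index is less than [K]; hence
       [K.+1] distinct choices are impossible. *)
    have [K cK] := cv _ cn.
    exists K.+1 => //; exists [fset i in iota 0 K]%fset; last first.
      by rewrite card_fseq undup_id ?iota_uniq// size_iota.
    apply/fsubsetP => i; rewrite pE => /LambdaP[j jK ->].
    have dj : indices d j by rewrite dE /=; lia.
    rewrite in_fset mem_iota add0n leq0n /= ltnNge; apply/negP.
    by move=> /(cK _ (rhod _ dj)); rewrite ltNge cnr.
  by have := fsubset_leq_card pF; rewrite pd; [lia|right].
- move=> j k dj dk jk; have [_ _ + _] := next _ dj; apply; first exact: rhod.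
  have [_ + _ _] := next _ dk; apply: contra; rewrite !pE => /LambdaP[i ij ->].
  by apply/LambdaP; exists i => //; lia.
- rewrite -pE; have kL k : (k <= #|` L|)%N -> (p k `<=` L)%fset.
    elim: k => [|k IHk] kL; first exact: fsub0set.
    have pkL := IHk (ltnW kL).
    have dk : indices d k.+1.
      apply: (@indices_le d k.+1 #|` L|); first by lia.
      by apply: card_indices => //; rewrite -cardfs_gt0; lia.
    rewrite [p _.+1]/= fsubUset pkL andbT fsub1set.
    have [_ _ _ + ] := next _ dk.
    have [j jL jp] : exists2 j, j \in L & j \notin p k.
      apply: contrapT => /forallPNP Lp.
      have /fsubset_leq_card : (L `<=` p k)%fset.
        by apply/fsubsetP => j /Lp /negP; rewrite negbK.
      by rewrite pd; [lia|exact: dS].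
    by apply; [exact: jL|].
  apply/eqP; rewrite eqEfcard kL//= pd//.
  have [->|L0] := eqVneq L fset0; first by left; rewrite cardfs0.
  by right; exact: card_indices.
Qed.

End greedy_ordering_existence.

(** * Coordinates and tails of expansions *)

Section basis.
Context {R : realType} {X : completeNormedModType R}.
Context (d : option nat) (e : nat -> X) (es : nat -> {linear X -> R^o}).

Definition basis_proj (A : {fset nat}) (x : X) : X :=
  \sum_(n <- A) es n x *: e n.

(** Subtracting the partial sum avoids the limit in [tail_sum], so linearity needs no convergence;
    [tail_sumE] identifies the two. *)
Definition basis_tail (k : nat) (x : X) : X := x - basis_proj (initial k) x.

Lemma basis_proj_linear A : linear (basis_proj A).
Proof.
move=> a x y; rewrite /basis_proj scaler_sumr -big_split/=.
apply: eq_bigr => n _.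
by rewrite linearP scalerDl scalerA.
Qed.

Lemma basis_tail_linear k : linear (basis_tail k).
Proof.
by move=> a x y; rewrite /basis_tail basis_proj_linear scalerBr opprD addrACA.
Qed.

HB.instance Definition _ k :=
  GRing.isLinear.Build R X X *:%R (basis_tail k) (basis_tail_linear k).

Context (Hes : biorthogonal d e es).

Lemma coord_sum (A : {fset nat}) (a : nat -> R) j :
  [set` A] `<=` indices d -> indices d j ->
  es j (\sum_(n <- A) a n *: e n) = if j \in A then a j else 0.
Proof.
move=> Ad dj; rewrite raddf_sum/=.
have esE n : n \in A -> es j (a n *: e n) = a n * (j == n)%:R.
  by move=> /Ad dn; rewrite linearZ/= Hes.2.
have [jA|jA] := boolP (j \in A).
  rewrite (big_fsetD1 j)//= esE// eqxx mulr1 big1_seq ?addr0// => n.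
  rewrite /= in_fsetD1 => /andP[nj nA].
  by rewrite esE// eq_sym (negbTE nj) mulr0.
rewrite big1_seq// => n /= nA; rewrite esE//.
by have [jn|] := eqVneq j n; rewrite ?mulr0//; move: jA; rewrite jn nA.
Qed.

(** The condition on [initial k] says that [k] is at most the dimension. Unlike [indices d k] it
    allows [k = 0], which occurs later for [k = alpha rho m - 1]. *)
Lemma basis_tail_sum0 (A : {fset nat}) (a : nat -> R) k :
  [set` A] `<=` indices d -> [set` initial k] `<=` indices d ->
  (A `<=` initial k)%fset -> basis_tail k (\sum_(n <- A) a n *: e n) = 0.
Proof.
move=> Ad kd Ak; apply/eqP; rewrite subr_eq0 eq_sym /basis_proj; apply/eqP.
rewrite -(big_fset_incl _ Ak) => [|n /kd dn /negbTE nA].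
  by apply: eq_big_seq => n nA; rewrite coord_sum ?nA//; exact: Ad.
by rewrite coord_sum// nA scale0r.
Qed.

Lemma coord_basis_tail j k x :
  [set` initial k] `<=` indices d -> indices d j ->
  es j (basis_tail k x) = if (j <= k)%N then 0 else es j x.
Proof.
move=> kd dj; rewrite /basis_tail linearB/= coord_sum// in_initial.
rewrite (indices_gt0 dj)/=.
by case: ifP => _; rewrite ?subrr ?subr0.
Qed.

Context (He : schauder_basis d e).

(** By continuity, [es j] of the partial sums tends to [es j x]; these values are constantly [a j]
    once the partial sum includes the index [j]. *)
Lemma expansion_coord (x : X) : expansion d e x (es ^~ x).
Proof.
have [a [ax _]] := He x.
have aE j : indices d j -> a j = es j x.
  move=> dj; move: ax; rewrite /expansion; case dE : d => [N|].
    rewrite -big_initial => <-.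
    have Nd : [set` initial N] `<=` indices d.
      by move=> i; rewrite /= in_initial dE.
    by rewrite coord_sum// in_initial; move: dj; rewrite dE/= => ->.
  move=> ax; apply: (@cvg_unique _ (@norm_hausdorff _ R^o) ((fun k =>
    es j (\sum_(1 <= n < k.+1) a n *: e n)) @ \oo)); last first.
    by apply: cvg_comp ax _; apply: Hes.1.
  apply: cvg_near_cst; near=> k; rewrite -big_initial coord_sum//.
    have jk : (j <= k)%N by near: k; exact: nbhs_infty_ge.
    by rewrite in_initial (indices_gt0 dj) jk.
  by apply: initial_indices; rewrite dE/=; near: k; exact: nbhs_infty_gt.
move: ax; rewrite /expansion; case dE : d => [N|].
  move=> xE; rewrite -[RHS]xE; apply: eq_big_nat => n nN.
  by rewrite aE// dE/=; lia.
apply: cvg_trans; apply: near_eq_cvg; near=> k.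
by apply: eq_big_nat => n nk; rewrite aE// dE/=; lia.
Unshelve. all: by end_near. Qed.

Lemma basis_tail_cvg0 (x : X) : d = None ->
  basis_tail k x @[k --> \oo] --> (0 : X).
Proof.
move=> dE; have := expansion_coord x; rewrite dE /= => xE.
rewrite -(subrr x); apply: cvgB; first exact: cvg_cst.
by under eq_cvg do rewrite /basis_proj big_initial.
Qed.

Lemma tail_sumE (x : X) m : indices d m ->
  tail_sum d (fun n => es n x *: e n) m = basis_tail m x.
Proof.
move=> dm; have := expansion_coord x; rewrite /tail_sum /expansion.
have sumB k : (m <= k)%N -> \sum_(m.+1 <= n < k.+1) es n x *: e n =
    \sum_(1 <= n < k.+1) es n x *: e n - basis_proj (initial m) x.
  move=> mk; rewrite /basis_proj big_initial (@big_cat_nat _ _ _ m.+1 1)//=.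
  by rewrite addrAC subrr add0r.
case dE : d => [N|].
  by move=> xE; rewrite sumB ?xE//; move: dm; rewrite dE/=; lia.
move=> xE; apply: cvg_lim; first exact: norm_hausdorff.
apply: cvg_trans (cvgB xE (cvg_cst (basis_proj (initial m) x))).
apply: near_eq_cvg; near=> k; rewrite sumB//.
by near: k; exact: nbhs_infty_ge.
Unshelve. all: by end_near. Qed.

Lemma basis_proj_bounded A :
  [set` A] `<=` indices d -> bounded_fun_norm (basis_proj A).
Proof.
move=> Ad r.
have /boolp.choice[M MP] : forall n, exists M : R,
    indices d n -> forall x : X, `|x| <= r -> `|es n x| <= M.
  move=> n; have [dn|] := pselect (indices d n); last by exists 0.
  have [|M MP] := (bounded_funP (es n)).2 _ r; last by exists M.
  by apply: continuous_linear_bounded; exact: Hes.1.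
exists (\sum_(n <- A) M n * `|e n|) => x xr.
apply: (le_trans (ler_norm_sum _ _ _)); rewrite !big_seq.
apply: ler_sum => n nA.
by rewrite normrZ ler_wpM2r// MP//; exact: Ad.
Qed.

(** Banach-Steinhaus for the tail operators. They are pointwise bounded by the sum of all the terms'
    norms in finite dimension, and because the tails of [x] converge to 0 otherwise. *)
Lemma basis_tail_uniformly_bounded : exists2 K : R, 0 < K &
  forall k x, [set` initial k] `<=` indices d -> `|basis_tail k x| <= K * `|x|.
Proof.
pose F := [set f |
  exists2 k, [set` initial k] `<=` indices d & f = basis_tail k].
have [f [k kd ->]|x|M MP] := @Banach_Steinhauss _ X X F _ _ 1.
- split; last exact: basis_tail_linear.
  move=> r; have [M MP] := basis_proj_bounded kd r; exists (r + M) => x xr.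
  by rewrite (le_trans (ler_normB _ _))// lerD// MP.
- have [M MP] : exists M, forall k, [set` initial k] `<=` indices d ->
      `|basis_tail k x| <= M.
    case dE : d => [N|].
      exists (`|x| + \sum_(n <- initial N) `|es n x *: e n|) => k kN.
      rewrite (le_trans (ler_normB _ _))// lerD//.
      rewrite (le_trans (ler_norm_sum _ _ _))//.
      have kN' : (initial k `<=` initial N)%fset.
        by apply/fsubsetP => n /kN; rewrite in_initial.
      rewrite [leRHS](big_fsetIDset _ (initial k)) (fsetIidPr kN').
      by rewrite lerDl sumr_ge0.
    have /cvg_seq_bounded tail_bounded : cvgn (fun k => basis_tail k x).
      by apply/cvg_ex; exists 0; exact: basis_tail_cvg0.
    have setT0 : [set: nat] 0%N by [].
    have [M MP] :=
      (@ex_bound _ _ _ _ _ (globally_properfilter setT0)).1 tail_bounded.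
    by exists M => k _; exact: MP.
  by exists M => _ [k /MP kM ->].
exists (Num.max 1 M); first by rewrite lt_max ltr01.
move=> k x kd; have [->|x0] := eqVneq x 0.
  by rewrite linear0 !normr0 mulr0.
have xgt0 : 0 < `|x| by rewrite normr_gt0.
have := MP (basis_tail k) _ (`|x|^-1 *: x).
rewrite linearZ/= !normrZ normfV normr_id mulVf ?gt_eqF// => tM.
rewrite (@le_trans _ _ (M * `|x|))//; last first.
  by rewrite ler_wpM2r// le_max lexx orbT.
by rewrite -ler_pdivrMr// mulrC tM//; exists k.
Qed.

Context (Hn : seminormalized d e).

Lemma norm_basis_ge :
  exists2 c : R, 0 < c & forall n, indices d n -> c <= `|e n|.
Proof.
have [inf0 _] := Hn.
have infle n : indices d n ->
    (ereal_inf [set (`|e n|%:E : \bar R) | n in indices d] <= `|e n|%:E)%E.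
  by move=> dn; apply: ereal_inf_lbound; exists n.
case: (ereal_inf _) inf0 infle => [c||]//.
- by rewrite lte_fin => c0 ce; exists c => // n /ce.
(* The infimum is [+oo] only if there are no indices, that is, in dimension 0. *)
- by move=> _ ce; exists 1 => // n /ce.
Qed.

(** The term [es n x *: e n] is the difference of two consecutive tails, which tend to 0, and the
    norms of the [e n] are bounded below. *)
Lemma coord_vanishing x : vanishing d (fun n => `|es n x|).
Proof.
move=> r r0; case dE : d => [N|]; first by exists N.+1 => n /=; lia.
have [c c0 ce] := norm_basis_ge.
have /cvgr0Pnorm_lt tail0 := basis_tail_cvg0 x dE.
have [|N _ NP] := tail0 (r * c / 2); first by rewrite divr_gt0 ?mulr_gt0.
exists N.+1 => n n0 Nn; rewrite -(ltr_pM2r c0).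
have dn : indices d n by rewrite dE.
rewrite (le_lt_trans (ler_wpM2l _ (ce _ dn)))// -normrZ.
have -> : es n x *: e n = basis_tail n.-1 x - basis_tail n x.
  rewrite /basis_tail opprB addrC addrA subrK.
  rewrite /basis_proj !big_initial; case: n n0 {Nn dn} => // n _.
  by rewrite [in X in X - _]big_nat_recr//= addrAC subrr add0r.
rewrite (le_lt_trans (ler_normB _ _))// [ltRHS]splitr ltrD//.
  by apply: NP => /=; lia.
by apply: NP => /=; lia.
Qed.

End basis.

(** * Greedy sets *)

Lemma alpha_le rho m n : n \in Lambda rho m -> (alpha rho m <= n)%N.
Proof.
rewrite /alpha.
have -> : n \in Lambda rho m = (n \in enum_fset (Lambda rho m)) by [].
elim: (enum_fset _) => // k s IHs; rewrite inE big_cons geq_min.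
by move=> /predU1P[->|/IHs ->]; rewrite ?leqnn ?orbT.
Qed.

Lemma alpha_gt rho m i : (0 < m)%N ->
  (forall n, n \in Lambda rho m -> (i < n)%N) -> (i < alpha rho m)%N.
Proof.
move=> m0 iL; rewrite /alpha big_seq; apply: (big_ind (fun v => i < v)%N) => //.
- by apply: iL; apply/LambdaP; exists 1%N.
- by move=> v w; rewrite leq_min => -> ->.
Qed.

Section greedy_sets.
Context {R : realType} {X : completeNormedModType R}.
Context (d : option nat) (e : nat -> X) (es : nat -> {linear X -> R^o}).

(** By [Lambda_greedy_set] and [greedy_set_ordering], the nonempty greedy sets are the sets
    [Lambda rho m] of the greedy orderings, whichever way ties are broken. *)
Definition greedy_set (x : X) (L : {fset nat}) : Prop :=
  [set` L] `<=` indices d /\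
  forall n j, n \in L -> j \notin L -> indices d j -> `|es j x| <= `|es n x|.

Lemma greedy_set_ordering x L : vanishing d (fun n => `|es n x|) ->
  greedy_set x L ->
  exists2 rho, greedy_ordering d es x rho & Lambda rho #|` L| = L.
Proof.
move=> xv [Ld gL].
have [|rho [rhod rhoI rhoS rhoM LE]] := greedy_order_exists _ xv Ld gL.
  by move=> n.
exists rho => //; split => //; apply: subset_trans rhoS => n [dn nx].
by rewrite /= normr_gt0.
Qed.

Section ordering.
Context (x : X) (rho : nat -> nat) (m : nat).
Context (Hrho : greedy_ordering d es x rho) (dm : indices d m).

Lemma Lambda_indices : [set` Lambda rho m] `<=` indices d.
Proof.
have [rhod _ _ _] := Hrho.
by move=> n /= /LambdaP[j jm ->]; apply: rhod; apply: indices_le dm.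
Qed.

Lemma card_Lambda : #|` Lambda rho m| = m.
Proof.
have [_ rhoI _ _] := Hrho.
rewrite card_in_imfset /= ?undup_id ?iota_uniq ?size_iota//.
move=> i j; rewrite !mem_iota => im jm; apply: rhoI; rewrite inE.
  by apply: indices_le dm; lia.
by apply: indices_le dm; lia.
Qed.

Lemma Lambda_ge n : n \in Lambda rho m -> `|es (rho m) x| <= `|es n x|.
Proof.
have [_ _ _ mon] := Hrho.
move=> /LambdaP[j jm ->]; have [->//|jNm] := eqVneq j m.
by apply: mon => //; [apply: indices_le dm|]; lia.
Qed.

(** An ordering may omit indices outside the support: [j] either has coefficient 0 or is chosen
    after step [m]. *)
Lemma notin_Lambda_le j : indices d j -> j \notin Lambda rho m ->
  `|es j x| <= `|es (rho m) x|.
Proof.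
have [_ _ sup mon] := Hrho.
move=> dj jL; have [->|jx] := eqVneq (es j x) 0; first by rewrite normr0.
have [k dk kj] := sup _ (conj dj jx); rewrite -kj; apply: mon => //.
rewrite ltnNge; apply: contra jL => km; apply/LambdaP; exists k => //.
by rewrite km (indices_gt0 dk).
Qed.

Lemma Lambda_greedy_set : greedy_set x (Lambda rho m).
Proof.
split; first exact: Lambda_indices.
move=> n j nL jL dj; apply: le_trans (Lambda_ge nL); exact: notin_Lambda_le.
Qed.

End ordering.

(** * The two properties on greedy sets, and the two implications *)

Context (He : schauder_basis d e) (Hn : seminormalized d e)
  (Hes : biorthogonal d e es).

Lemma partially_greedy_set : partially_greedy d e es -> exists2 C : R, 0 < C &
  forall x L, greedy_set x L -> L != fset0 ->
    `|x - basis_proj e es L x| <= C * `|basis_tail e es #|` L| x|.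
Proof.
move=> [C CP]; exists (Num.max 1 C); first by rewrite lt_max ltr01.
move=> x L gL L0.
have [rho rhoP LE] := greedy_set_ordering (coord_vanishing Hes He Hn x) gL.
have dL := card_indices gL.1 L0.
have := CP x rho _ rhoP dL; rewrite /G LE (tail_sumE Hes He)//.
move=> /le_trans; apply.
by rewrite ler_wpM2r// le_max lexx orbT.
Qed.

(** The real [inf] is meaningful only for nonempty sets bounded below: here 0 is a lower bound, and
    in [le_sigmaL] the empty [A] gives an element. *)
Lemma sigmaL_le x rho m A (a : nat -> R) : [set` A] `<=` indices d ->
  (#|` A| <= m)%N -> (forall i, i \in A -> (i < alpha rho m)%N) ->
  sigmaL d e x rho m <= `|x - \sum_(i <- A) a i *: e i|.
Proof.
move=> Ad Am Aal; apply: ge_inf; last by exists A, a.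
by exists 0 => _ [B [b [_ _ _ ->]]].
Qed.

Lemma le_sigmaL x rho m r :
  (forall A (a : nat -> R), [set` A] `<=` indices d ->
    (#|` A| <= m)%N -> (forall i, i \in A -> (i < alpha rho m)%N) ->
    r <= `|x - \sum_(i <- A) a i *: e i|) ->
  r <= sigmaL d e x rho m.
Proof.
move=> rP; apply: lb_le_inf; last by move=> _ [A [a [Ad Am Aal ->]]]; exact: rP.
exists `|x - \sum_(i <- fset0) 0 *: e i|; exists fset0, (fun=> 0); split => //.
Qed.

(** Property (b) is applied with the coefficients [a i = es i x]. Passing to [|C|] is harmless
    because [sigmaL] is nonnegative. *)
Lemma property_star_set : property_star d e es -> exists2 C : R, 0 <= C &
  forall x L A, greedy_set x L -> L != fset0 -> [set` A] `<=` indices d ->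
    (#|` A| <= #|` L|)%N -> (forall i n, i \in A -> n \in L -> (i < n)%N) ->
    `|x - basis_proj e es L x| <= C * `|x - basis_proj e es A x|.
Proof.
move=> [C CP]; exists `|C| => // x L A gL L0 Ad AL ltAL.
have [rho rhoP LE] := greedy_set_ordering (coord_vanishing Hes He Hn x) gL.
have dL := card_indices gL.1 L0.
have := CP x rho _ rhoP dL; rewrite /G LE => /le_trans; apply.
have sig0 : 0 <= sigmaL d e x rho #|` L| by apply: le_sigmaL.
rewrite (le_trans (ler_wpM2r sig0 (ler_norm C)))// ler_wpM2l//.
apply: sigmaL_le => // i iA; apply: alpha_gt; first exact: indices_gt0 dL.
by move=> n; rewrite LE; exact: ltAL.
Qed.

Lemma partially_greedy_of_star :
  property_star d e es -> partially_greedy d e es.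
Proof.
move=> /property_star_set[C C0 CP]; exists (Num.max 1 C) => x rho m rhoP dm.
rewrite (tail_sumE Hes He)//.
set L := Lambda rho m; pose I := initial m.
have Id : [set` I] `<=` indices d := initial_indices dm.
have Ld : [set` L] `<=` indices d := Lambda_indices rhoP dm.
pose B := (L `&` I)%fset; pose z := x - basis_proj e es B x.
have Bd : [set` B] `<=` indices d.
  by move=> n /=; rewrite in_fsetI => /andP[_ /Id].
have coordz n : indices d n -> es n z = if n \in B then 0 else es n x.
  move=> dn; rewrite linearB/= (coord_sum Hes)//.
  by case: ifP => _; rewrite ?subrr ?subr0.
have zL : z - basis_proj e es (L `\` I)%fset z = x - basis_proj e es L x.
  have -> : basis_proj e es (L `\` I)%fset z = basis_proj e es (L `\` I)%fset x.
    apply: eq_big_seq => n; rewrite in_fsetD => /andP[nI nL].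
    by rewrite coordz ?in_fsetI ?(negbTE nI) ?andbF//; exact: Ld.
  by rewrite {2}/basis_proj (big_fsetIDset L I) opprD addrA.
have zI : z - basis_proj e es (I `\` L)%fset z = basis_tail e es m x.
  have -> : basis_proj e es (I `\` L)%fset z = basis_proj e es (I `\` L)%fset x.
    apply: eq_big_seq => n; rewrite in_fsetD => /andP[nL nI].
    by rewrite coordz ?in_fsetI ?(negbTE nL)//; exact: Id.
  rewrite /basis_tail {2}/basis_proj (big_fsetIDset I L) opprD addrA.
  by rewrite [(I `&` L)%fset]fsetIC.
(* If [L] lies in [I], equal cardinalities give [L = I], and both sides are norms of the same
   vector; this is why the constant is at least 1. *)
have [LI|LI] := eqVneq (L `\` I)%fset fset0.
  have LIE : L = I.
    apply/eqP; rewrite eqEfcard -fsetD_eq0 LI eqxx/=.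
    by rewrite card_initial (card_Lambda rhoP dm).
  by rewrite /G -/L LIE ler_peMl ?le_max ?lexx.
rewrite -zL -zI (le_trans (CP z _ (I `\` L)%fset _ LI _ _ _))//.
- split; first by move=> n /=; rewrite in_fsetD => /andP[_ /Ld].
  move=> n j; rewrite !in_fsetD => /andP[nI nL].
  rewrite negb_and negbK => jIL dj.
  rewrite !coordz ?in_fsetI ?(negbTE nI) ?andbF//; last exact: Ld.
  case: ifP => [_|jB]; first by rewrite normr0.
  have [_] := Lambda_greedy_set rhoP dm; apply=> //.
  by apply/negP => jL; move: jIL jB; rewrite -/L jL orbF => ->.
- by move=> n /=; rewrite in_fsetD => /andP[_ /Id].
- rewrite -(leq_add2l #|` (L `&` I)%fset|) cardfsID fsetIC cardfsID.
  by rewrite card_initial (card_Lambda rhoP dm).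
- move=> i n; rewrite !in_fsetD !in_initial => /andP[_ iI] /andP[nI nL].
  have := indices_gt0 (Ld _ nL); lia.
- by rewrite ler_wpM2r// le_max lexx orbT.
Qed.

Lemma star_of_partially_greedy :
  partially_greedy d e es -> property_star d e es.
Proof.
move=> /partially_greedy_set[C C0 CP].
have [K K0 KP] := basis_tail_uniformly_bounded Hes He.
have CK0 : 0 < 3 * (C * K) by rewrite mulr_gt0 ?mulr_gt0.
(* The constant is moved to the left so that the bound on the infimum can be checked for each
   competitor separately. *)
exists (3 * (C * K)) => x rho m rhoP dm; rewrite -ler_pdivrMl//.
apply: le_sigmaL => A a Ad Am Aalpha; rewrite ler_pdivrMl// /G.
set L := Lambda rho m; set y := x - \sum_(i <- A) _.
have Ld : [set` L] `<=` indices d := Lambda_indices rhoP dm.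
have Lge n : n \in L -> `|es (rho m) x| <= `|es n x|.
  exact: (Lambda_ge rhoP dm).
have Lle j : indices d j -> j \notin L -> `|es j x| <= `|es (rho m) x|.
  exact: (notin_Lambda_le rhoP dm).
set tau := `|es (rho m) x| in Lge Lle.
pose I := initial (alpha rho m).-1.
have IL j : j \in I -> j \notin L.
  rewrite in_initial => jI; apply/negP => /alpha_le; lia.
have AI : (A `<=` I)%fset.
  apply/fsubsetP => i iA; rewrite in_initial.
  by have := Aalpha _ iA; have := indices_gt0 (Ad _ iA); lia.
have rhomL : rho m \in L.
  by apply/LambdaP; exists m => //; rewrite leqnn (indices_gt0 dm).
have Id : [set` I] `<=` indices d.
  move=> i /=; rewrite in_initial => iI; apply: indices_le (Ld _ rhomL).
  by have := alpha_le rhomL; lia.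
have AL j : j \in A -> j \notin L by move=> /(fsubsetP AI)/IL.
pose B := (I `\` A)%fset; pose S := (B `|` L)%fset.
have Bd : [set` B] `<=` indices d.
  by move=> i; rewrite /= in_fsetD => /andP[_ /Id].
have BL : [disjoint B & L]%fset.
  apply/fdisjointP => j; rewrite in_fsetD => /andP[_]; exact: IL.
have Sd : [set` S] `<=` indices d.
  by move=> j; rewrite /= in_fsetU => /orP[/Bd|/Ld].
have S0 : S != fset0.
  by apply/fset0Pn; exists (rho m); rewrite in_fsetU rhomL orbT.
have dS := card_indices Sd S0.
have IS : (I `<=` initial #|` S|)%fset.
  apply: initial_subset; rewrite -[leqLHS]card_initial -/I.
  rewrite -(cardfsID A I) (fsetIidPr AI) cardfsU (disjoint_fsetI0 BL).
  rewrite cardfs0 subn0.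
  by rewrite addnC leq_add2l (card_Lambda rhoP dm).
have SdI := initial_indices dS.
have tail0 (D : {fset nat}) (b : nat -> R) : (D `<=` I)%fset ->
    basis_tail e es #|` S| (\sum_(n <- D) b n *: e n) = 0.
  move=> DI; apply: (basis_tail_sum0 Hes) => //; last exact: fsubset_trans IS.
  by move=> n /(fsubsetP DI)/Id.
pose Q := basis_tail e es (alpha rho m).-1 x - basis_proj e es L x.
have key (u : nat -> R) : (forall i, i \in A -> `|u i| <= tau) ->
    `|Q + \sum_(i <- A) u i *: e i| <= C * K * `|y|.
  move=> utau.
  pose w := basis_tail e es (alpha rho m).-1 x + \sum_(i <- A) u i *: e i
            + \sum_(i <- B) tau *: e i.
  have coordw j : indices d j -> es j w =
      if j \in A then u j else if j \in B then tau else es j x.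
    move=> dj; rewrite 2!linearD/= (coord_basis_tail Hes)//.
    rewrite (coord_sum Hes)// (coord_sum Hes _ Bd)// in_fsetD in_initial.
    rewrite (indices_gt0 dj)/=.
    have [jA|jA] := boolP (j \in A).
      have := fsubsetP AI _ jA; rewrite in_initial (indices_gt0 dj)/= => ->.
      by rewrite add0r addr0.
    by case: ifP => _; rewrite /= ?addr0 ?add0r.
  have coordwL n : n \in L -> es n w = es n x.
    move=> nL; rewrite coordw; last exact: Ld.
    have /negbTE -> : n \notin A by apply: contraL nL => /AL.
    by have /negbTE -> : n \notin B by apply: contraL nL => /(fdisjointP BL).
  have coordwB n : n \in B -> es n w = tau.
    move=> nB; rewrite coordw; last exact: Bd.
    by rewrite nB; move: nB; rewrite in_fsetD => /andP[/negbTE ->].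
  have gS : greedy_set w S.
    split=> // n j nS; rewrite in_fsetU negb_or => /andP[jB jL] dj.
    apply: (@le_trans _ _ tau).
      rewrite coordw// (negbTE jB); case: ifP => [/utau//|_]; exact: Lle.
    move: nS; rewrite in_fsetU => /orP[/coordwB ->|nL]; first exact: ler_norm.
    by rewrite coordwL//; exact: Lge.
  (* On [S] the projection of [w] is the sum of [tau *: e i] over [B] plus the projection of [x]
     onto [L]; the sum over [B] cancels. *)
  have -> : Q + \sum_(i <- A) u i *: e i = w - basis_proj e es S w.
    rewrite /basis_proj big_fsetUdisj//.
    rewrite [X in _ - (X + _)](eq_big_seq (fun n => tau *: e n));
      last by move=> n /coordwB ->.
    rewrite [X in _ - (_ + X)](eq_big_seq (fun n => es n x *: e n));
      last by move=> n /coordwL ->.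
    by rewrite opprD addrA addrK addrAC.
  rewrite (le_trans (CP _ _ gS S0))// -mulrA ler_wpM2l ?(ltW C0)//.
  (* Both [w] and [y] differ from [x] by combinations of the [e i] with [i] in [I], which the tail
     operator kills. *)
  have -> : basis_tail e es #|` S| w = basis_tail e es #|` S| y.
    transitivity (basis_tail e es #|` S| x).
      rewrite /w 2!linearD/= !tail0 ?fsubsetDl// !addr0.
      rewrite [basis_tail e es _.-1 x]/basis_tail linearB/= /basis_proj.
      by rewrite tail0// subr0.
    by rewrite /y linearB/= tail0// subr0.
  exact: KP.
have coordy j : indices d j -> j \notin A -> es j y = es j x.
  by move=> dj jA; rewrite linearB/= (coord_sum Hes)// (negbTE jA) subr0.
pose A1 := [fset i in A | tau <= `|es i y|]%fset.
have A1A : (A1 `<=` A)%fset by apply/fsubsetP => i; rewrite !inE => /andP[].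
have A1L : [disjoint A1 & L]%fset by apply/fdisjointP => i /(fsubsetP A1A)/AL.
have gS1 : greedy_set y (A1 `|` L)%fset.
  split; first by move=> j; rewrite /= in_fsetU => /orP[/(fsubsetP A1A)/Ad|/Ld].
  move=> n j nS; rewrite in_fsetU negb_or => /andP[jA1 jL] dj.
  apply: (@le_trans _ _ tau).
    have [jA|jA] := boolP (j \in A); last by rewrite coordy//; exact: Lle.
    by move: jA1; rewrite !inE jA/= -ltNge => /ltW.
  move: nS; rewrite in_fsetU => /orP[|nL]; first by rewrite !inE => /andP[].
  rewrite coordy ?Lge//; first exact: Ld.
  by apply: contraL nL => /AL.
have S10 : (A1 `|` L)%fset != fset0.
  by apply/fset0Pn; exists (rho m); rewrite in_fsetU rhomL orbT.
pose v i := if i \in A1 then 0 else es i y.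
have -> : x - basis_proj e es L x = (y - basis_proj e es (A1 `|` L)%fset y)
    + ((Q + basis_proj e es A x) - (Q + \sum_(i <- A) v i *: e i)).
  have -> : basis_proj e es (A1 `|` L)%fset y =
      basis_proj e es A1 y + basis_proj e es L x.
    rewrite /basis_proj big_fsetUdisj//; congr (_ + _).
    apply: eq_big_seq => n nL; rewrite coordy//; first exact: Ld.
    by apply: contraL nL => /AL.
  (* On [A] one has [es i y = es i x - a i]; the sum splits along [A1], where [v] vanishes. *)
  have yA : basis_proj e es A x - \sum_(i <- A) a i *: e i =
      basis_proj e es A1 y + \sum_(i <- A) v i *: e i.
    rewrite /basis_proj -sumrB (eq_big_seq (fun i => es i y *: e i)) => [|i iA].
      rewrite (big_fsetIDset A A1) [in RHS](big_fsetIDset A A1) (fsetIidPr A1A).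
      rewrite [X in _ = _ + (X + _)]big1_seq ?add0r => [|i /= iA1].
        congr (_ + _); apply: eq_big_seq => i; rewrite in_fsetD /v.
        by case/andP => /negbTE ->.
      by rewrite /v iA1 scale0r.
    by rewrite -scalerBl linearB/= (coord_sum Hes) ?iA//; exact: Ad.
  move/eqP: yA; rewrite subr_eq => /eqP ->.
  rewrite [Q + (_ + _)]addrC addrKA [_ - \sum_(_ <- _) v _ *: _]addrAC addrK.
  rewrite opprD [- _ - _]addrC -!addrA addKr [- _ + (_ + _)]addrCA.
  by rewrite addNr addr0.
(* The factor 3 counts one bound for the greedy set of [y] and two uses of [key]. *)
rewrite (le_trans (ler_normD _ _))// -mulrA mulr_natl mulrS lerD//.
  rewrite (le_trans (CP _ _ gS1 S10))// -mulrA ler_wpM2l ?(ltW C0)//; apply: KP.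
  exact: initial_indices (card_indices gS1.1 S10).
rewrite (le_trans (ler_normB _ _))// mulr2n lerD//; apply: key => i iA.
  by apply: Lle; [exact: Ad|exact: AL].
rewrite /v; case: ifP => [_|]; first by rewrite normr0 normr_ge0.
by rewrite !inE iA/= => /negbT; rewrite -ltNge => /ltW.
Qed.

End greedy_sets.

Theorem theorem2p9 (R : realType) (X : completeNormedModType R)
    (d : option nat) (e : nat -> X) (es : nat -> {linear X -> R^o})
    (He : schauder_basis d e) (Hn : seminormalized d e)
    (Hes : biorthogonal d e es) :
  partially_greedy d e es <-> property_star d e es.
Proof.
by split; [exact: star_of_partially_greedy|exact: partially_greedy_of_star].
Qed.
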